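(* Let $\mathcal{P}$ be an $\ell$-dimensional LR-vine and let $(G,\lambda)=\Omega(\mathcal{P})$. If $(v_1,\dots,v_\ell)$ is an MAT-PEO of $(G,\lambda)$, then $(v_1,\dots,v_\ell)$ is a sampling order of $\mathcal{P}$. As a consequence, every LR-vine has a sampling order.
   Context: Posets are finite. A graded poset has a rank function $\operatorname{rk}\colon\mathcal{P}\to\mathbb{Z}_{>0}$ with $x<y\Rightarrow\operatorname{rk}(x)<\operatorname{rk}(y)$, $\operatorname{rk}(y)=\operatorname{rk}(x)+1$ when $y$ covers $x$, and all minimal elements of rank $1$; $\mathcal{P}_i$ = elements of rank $i$, $\dim(\mathcal{P})$ = number of minimal elements, $\mathcal{E}(v)$ = elements covered by $v$. A vine is a graded poset in which every non-minimal element covers exactly two elements, any two distinct elements of the same rank are covered by at most one common element, and for each $1\le i\le\operatorname{rk}(\mathcal{P})$ the graph $F_i$ on $\mathcal{P}_i$ with edge set $\{\mathcal{E}(v)\mid v\in\mathcal{P}_{i+1}\}$ is a forest. An R-vine is a vine with $\operatorname{rk}(\mathcal{P})=\dim(\mathcal{P})$, each $F_i$ a tree, and proximity: distinct elements of the same rank $i\ge2$ covered by a common element cover a common element. An LR-vine is a vine all of whose principal ideals $\mathcal{P}_{\le v}$ (induced order and rank) are R-vines. For $v\in\mathcal{P}$, $U_v$ = set of minimal elements $\le v$; for non-minimal $v$ covering $a,b$, its conditioned set is $C_v=U_a\triangle U_b$. $\Omega(\mathcal{P})$ is the edge-labeled graph $(G,\lambda)$ with vertex set the minimal elements of $\mathcal{P}$,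 where $\{i,j\}$ ($i\ne j$) is an edge iff the join $i\vee j$ exists in $\mathcal{P}$, with label $\lambda(i,j)=\operatorname{rk}(i\vee j)-1$. For an edge-labeled graph $(G,\lambda)$, a vertex $v$ is MAT-simplicial if (MS1) its neighborhood is a clique; (MS2) the labels of edges incident to $v$ are exactly $\{1,2,\dots,\deg_G(v)\}$; (MS3) for distinct neighbors $u_1,u_2$ of $v$, $\lambda(u_1,u_2)<\max\{\lambda(u_1,v),\lambda(u_2,v)\}$. An ordering $(v_1,\dots,v_\ell)$ of the vertices is an MAT-PEO if for each $i$, $v_i$ is MAT-simplicial in $(G_i,\lambda_i)$, where $G_i=G[\{v_1,\dots,v_i\}]$ is the induced subgraph and $\lambda_i=\lambda|_{E_{G_i}}$. For a minimal element $v$ of an LR-vine $\mathcal{P}$, the marginalization $\mathcal{P}\,\|\,v$ is the induced subposet $\mathcal{P}\setminus(\{v\}\cup\{x\in\mathcal{P}\mid v\in C_x\})$. An induced subposet $\mathcal{Q}$ is graded by $\operatorname{rk}_{\mathcal{P}}$ if $\operatorname{rk}_{\mathcal{P}}|_{\mathcal{Q}}$ is a rank function on $\mathcal{Q}$. An ordering $(v_1,\dots,v_\ell)$ of the minimal elements of an $\ell$-dimensional LR-vine $\mathcal{P}$ is a sampling order if, with $\mathcal{P}_\ell:=\mathcal{P}$ and $\mathcal{P}_i:=\mathcal{P}_{i+1}\,\|\,v_{i+1}$, each $\mathcal{P}_i$ ($1\le i\le\ell-1$) is an LR-vine graded by $\operatorname{rk}_{\mathcal{P}}$. *)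

(* Defs.v *)
From mathcomp Require Import all_boot all_order.

Set Implicit Arguments.
Unset Strict Implicit.
Unset Printing Implicit Defensive.

Import Order.TTheory.

(* Finite simple graphs on a set of vertices. An edge is a two-element set of
   vertices; [adj] ignores any other member of [edges], so that every record
   denotes a simple graph. *)
Record graph (V : finType) := Graph {
  vertices : {set V};
  edges : {set {set V}} }.

Section Graphs.
Variables (V : finType).
Implicit Types (G : graph V).

Definition adj G : rel V := fun x y =>
  [&& x \in vertices G, y \in vertices G, x != y & [set x; y] \in edges G].

Definition forest G : Prop :=
  forall c : seq V,
    {subset c <= vertices G} -> ucycle (adj G) c -> size c < 3.

Definition connected G : Prop :=
  {in vertices G &, forall x y, connect (adj G) x y}.

Definition tree G : Prop :=
  [/\ vertices G != set0, connected G & forest G].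

End Graphs.

(* [label] is relevant only on the edges. *)
Record lgraph (V : finType) := LGraph {
  lgraph_graph :> graph V;
  label : {set V} -> nat }.

Section LabeledGraphs.
Variables (V : finType).
Implicit Types (G : lgraph V).

Definition neighbors G (v : V) : {set V} := [set u | adj G v u].

Definition deg G (v : V) : nat := #|neighbors G v|.

Definition induced G (S : {set V}) : lgraph V :=
  LGraph (Graph (vertices G :&: S) [set e in edges G | e \subset S]) (label G).

Definition MS1 G (v : V) : Prop :=
  {in neighbors G v &, forall u1 u2, u1 != u2 -> adj G u1 u2}.

Definition MS2 G (v : V) : Prop :=
  forall k : nat,
    (exists2 u, u \in neighbors G v & label G [set u; v] = k)
    <-> 1 <= k <= deg G v.

Definition MS3 G (v : V) : Prop :=
  {in neighbors G v &, forall u1 u2, u1 != u2 ->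
    label G [set u1; u2] < maxn (label G [set u1; v]) (label G [set u2; v])}.

Definition MAT_simplicial G (v : V) : Prop :=
  [/\ v \in vertices G, MS1 G v, MS2 G v & MS3 G v].

Definition ordering_of (A : {set V}) (l : nat) (v : l.-tuple V) : Prop :=
  uniq v /\ v =i A.

(* Indices start at 0: [tnth v i] is v_(i+1), and [take i.+1 v] lists
   v_1, ..., v_(i+1). *)
Definition MAT_PEO G (l : nat) (v : l.-tuple V) : Prop :=
  ordering_of (vertices G) v /\
  forall i : 'I_l,
    MAT_simplicial (induced G [set x in take i.+1 v]) (tnth v i).

End LabeledGraphs.

(* Every notion below is relative to a subset [A] of a finite poset [T], and is
   that of the induced subposet [A]; covering relations and minimal elements
   are thus computed in [A]. *)
Section Vines.
Variables (d : Order.disp_t) (T : finPOrderType d).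
Implicit Types (A : {set T}) (x y v : T) (rk : T -> nat).

Definition covers A x y : bool :=
  [&& x \in A, y \in A, (x < y)%O & [forall z in A, ~~ (x < z < y)%O]].

Definition minimals A : {set T} := [set x in A | [forall y in A, ~~ (y < x)%O]].

Definition dim A : nat := #|minimals A|.

Definition is_rank_function A rk : Prop :=
  [/\ {in A, forall x, 0 < rk x},
      {in A &, forall x y, (x < y)%O -> rk x < rk y},
      forall x y, covers A x y -> rk y = (rk x).+1
    & {in minimals A, forall x, rk x = 1}].

Definition level A rk (i : nat) : {set T} := [set x in A | rk x == i].

Definition rank A rk : nat := \max_(x in A) rk x.

Definition lower_covers A v : {set T} := [set x | covers A x v].

Definition level_graph A rk (i : nat) : graph T :=
  Graph (level A rk i) [set lower_covers A v | v in level A rk i.+1].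

Definition is_vine A rk : Prop :=
  [/\ is_rank_function A rk,
      {in A :\: minimals A, forall v, #|lower_covers A v| = 2},
      {in A &, forall x y, x != y -> rk x = rk y ->
         forall z1 z2, covers A x z1 -> covers A y z1 ->
                       covers A x z2 -> covers A y z2 -> z1 = z2}
    & forall i, 1 <= i <= rank A rk -> forest (level_graph A rk i)].

Definition proximity A rk : Prop :=
  {in A &, forall x y, x != y -> rk x = rk y -> 2 <= rk x ->
     (exists z, covers A x z /\ covers A y z) ->
     exists w, covers A w x /\ covers A w y}.

Definition is_Rvine A rk : Prop :=
  [/\ is_vine A rk,
      rank A rk = dim A,
      forall i, 1 <= i <= rank A rk -> tree (level_graph A rk i)
    & proximity A rk].

Definition principal_ideal A v : {set T} := [set x in A | (x <= v)%O].

Definition is_LRvine A rk : Prop :=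
  is_vine A rk /\ {in A, forall v, is_Rvine (principal_ideal A v) rk}.

Definition support A v : {set T} := [set m in minimals A | (m <= v)%O].

Definition symdiff (X Y : {set T}) : {set T} := (X :\: Y) :|: (Y :\: X).

(* If [v] covers exactly the two elements a and b, the diagonal terms vanish
   and this is [symdiff (support A a) (support A b)]; if [v] is minimal, it is
   empty. *)
Definition conditioned_set A v : {set T} :=
  \bigcup_(a in lower_covers A v) \bigcup_(b in lower_covers A v)
    symdiff (support A a) (support A b).

Definition marginalization A v : {set T} :=
  A :\: (v |: [set x in A | v \in conditioned_set A x]).

Definition is_join A (e : {set T}) (z : T) : bool :=
  [&& z \in A, [forall x in e, (x <= z)%O]
    & [forall w in A, [forall x in e, (x <= w)%O] ==> (z <= w)%O]].

Definition Omega A rk : lgraph T :=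
  LGraph
    (Graph (minimals A)
       [set e : {set T} |
         [&& e \subset minimals A, #|e| == 2 & [exists z, is_join A e z]]])
    (fun e => if [pick z | is_join A e z] is Some z then (rk z).-1 else 0).

(* The poset P_i obtained from P_l = A by marginalizing v_l, ..., v_(i+1), in
   this order; [drop i v] lists v_(i+1), ..., v_l. *)
Definition marginal A (v : seq T) (i : nat) : {set T} :=
  foldr (fun x B => marginalization B x) A (drop i v).

Definition sampling_order A rk (l : nat) (v : l.-tuple T) : Prop :=
  ordering_of (minimals A) v /\
  forall i, 1 <= i <= l.-1 -> is_LRvine (marginal A v i) rk.

End Vines.

(* Main.v *)
(* Call a minimal element v simple if P has at most one element of each rank
   above v. Marginalizing a simple v removes exactly the elements above v, so it
   leaves a down-set of P, which is again an LR-vine. Hence an ordering whose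
   every v_i is simple in {x | U_x is contained in {v_1, ..., v_i}} is a
   sampling order.

   MAT-PEO: two elements x, y of P with a common lower bound have a meet,
   because two subtrees of a forest meet in a subtree. Hence x is determined by
   U_x, and bounded pairs have joins. By (MS2) the labels of the edges at v are
   distinct; as |U_y| = rk y, this determines U_y, and thus y, from rk y for
   all y >= v.

   Existence: let S be a set of minimal elements such that elements with support
   in S that are connected in some F_i are connected through elements with
   support in S. Since the F_i are forests, every v outside S is simple in the
   part of P supported in S + v. If v is chosen so that an element g of maximal
   rank satisfies U_g \ S = {v}, then S + v has the same property. *)

Require Import Defs.
From mathcomp Require Import all_boot all_order.

Set Implicit Arguments.
Unset Strict Implicit.
Unset Printing Implicit Defensive.

Import Order.TTheory.

(** * Down-sets of an LR-vine *)

Section DownSets.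
Variables (d : Order.disp_t) (T : finPOrderType d).
Implicit Types (A : {set T}) (x y z : T) (rk : T -> nat).

Definition down_set A : Prop := forall x y, x \in A -> (y <= x)%O -> y \in A.

Lemma down_set_ideal v : down_set (principal_ideal [set: T] v).
Proof. by move=> x y; rewrite !inE => xv yx; apply: le_trans yx xv. Qed.

Lemma down_set_covers A x y :
  down_set A -> covers A x y = covers [set: T] x y && (y \in A).
Proof.
move=> dA; rewrite /covers !inE /=; case yA: (y \in A); rewrite ?andbF ?andbT //=.
case: (boolP (x < y)%O) => xy /=; rewrite ?andbF // (dA _ _ yA (ltW xy)) /=.
apply/forall_inP/forall_inP => H z zA; last by apply: H; rewrite inE.
case: (boolP (z \in A)) => [/H //|zNA].
by apply/negP => /andP[_ zy]; rewrite (dA _ _ yA (ltW zy)) in zNA.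
Qed.

Lemma down_set_lower_covers A v :
  down_set A -> v \in A -> lower_covers A v = lower_covers [set: T] v.
Proof. by move=> dA vA; apply/setP=> x; rewrite !inE down_set_covers // vA andbT. Qed.

Lemma down_set_minimals A :
  down_set A -> minimals A = minimals [set: T] :&: A.
Proof.
move=> dA; apply/setP=> x; rewrite !inE andbC /=.
case: (boolP (x \in A)) => xA; rewrite ?andbT ?andbF //=.
apply/forall_inP/forall_inP => H y yA; last by apply: H; rewrite inE.
case: (boolP (y \in A)) => [/H //|yNA].
by apply/negP => yx; rewrite (dA _ _ xA (ltW yx)) in yNA.
Qed.

Lemma down_set_support A x :
  down_set A -> x \in A -> Defs.support A x = Defs.support [set: T] x.
Proof.
move=> dA xA; apply/setP=> m; rewrite /Defs.support down_set_minimals // !inE /=.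
by case: (boolP (m <= x)%O) => mx; rewrite ?andbF // (dA _ _ xA mx) !andbT.
Qed.

Lemma down_set_principal_ideal A v :
  down_set A -> v \in A -> principal_ideal A v = principal_ideal [set: T] v.
Proof.
move=> dA vA; apply/setP=> x; rewrite !inE andbC /=.
by case: (boolP (x <= v)%O) => // /(dA _ _ vA).
Qed.

Lemma adj_down_set A rk i x y : down_set A ->
  adj (level_graph A rk i) x y -> adj (level_graph [set: T] rk i) x y.
Proof.
move=> dA /and4P[]; rewrite !inE => /andP[_ xi] /andP[_ yi] xy /imsetP[v].
rewrite !inE => /andP[vA vi] e; rewrite /adj !inE xi yi xy /= e.
by rewrite down_set_lower_covers // imset_f // !inE vi.
Qed.

(** Members of a down-set keep their lower covers and principal ideals, and the level graphs of a
    down-set are subgraphs of forests. *)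
Lemma down_set_LRvine A rk :
  is_LRvine [set: T] rk -> down_set A -> is_LRvine A rk.
Proof.
move=> [[[rk0 rkS rkc rkm] l2 u f] hI] dA; split; last first.
  by move=> v vA; rewrite down_set_principal_ideal //; apply: hI; rewrite inE.
split.
- split.
  + by move=> x _; apply: rk0; rewrite inE.
  + by move=> x y _ _; apply: rkS; rewrite inE.
  + by move=> x y; rewrite down_set_covers // => /andP[/rkc].
  + by move=> x; rewrite down_set_minimals // => /setIP[/rkm].
- move=> v; rewrite inE down_set_minimals // => /andP[nm vA].
  rewrite down_set_lower_covers //; apply: l2; rewrite !inE /= andbT.
  by move: nm; rewrite !inE vA andbT.
- move=> x y _ _ xy exy z1 z2; rewrite !(down_set_covers _ _ dA).
  move=> /andP[a1 _] /andP[a2 _] /andP[a3 _] /andP[a4 _].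
  by apply: (u x y) => //; rewrite inE.
- move=> i /andP[i1 iA].
  have iT : 1 <= i <= rank [set: T] rk.
    rewrite i1 (leq_trans iA) //; apply/bigmax_leqP => x _.
    by apply: leq_bigmax_cond; rewrite inE.
  move=> c sc /andP[cc uc]; apply: (f i iT) => [x|]; last first.
    by apply/andP; split=> //; apply: sub_cycle cc => x y; apply: adj_down_set.
  by move=> /sc; rewrite !inE => /andP[].
Qed.
End DownSets.

Section LRvines.
Variables (d : Order.disp_t) (T : finPOrderType d) (rk : T -> nat).
Hypothesis hP : is_LRvine [set: T] rk.
Implicit Types (B S : {set T}) (a b c g q v w x y z : T).

Local Notation P1 := (minimals [set: T]).
Local Notation LC := (lower_covers [set: T]).
Local Notation U := (Defs.support [set: T]).

(** * Ranks and lower covers *)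

Lemma rk_lt x y : (x < y)%O -> rk x < rk y.
Proof. by case: hP => [[[_ H _ _] _ _ _] _] /H; apply; rewrite inE. Qed.

Lemma rk_le x y : (x <= y)%O -> rk x <= rk y.
Proof. by rewrite le_eqVlt => /predU1P[->//|/rk_lt/ltnW]. Qed.

Lemma rk_gt0 x : 0 < rk x.
Proof. by case: hP => [[[H _ _ _] _ _ _] _]; apply: H; rewrite inE. Qed.

Lemma rk_minimal x : x \in P1 -> rk x = 1.
Proof. by case: hP => [[[_ _ _ H] _ _ _] _] /H. Qed.

Lemma rk_lower_cover x y : x \in LC y -> rk y = (rk x).+1.
Proof. by case: hP => [[[_ _ H _] _ _ _] _]; rewrite inE => /H. Qed.

Lemma lower_cover_lt x y : x \in LC y -> (x < y)%O.
Proof. by rewrite inE => /and4P[]. Qed.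

Lemma le_rk_eq x y : (x <= y)%O -> rk x = rk y -> x = y.
Proof. by rewrite le_eqVlt => /predU1P[//|/rk_lt] H e; rewrite e ltnn in H. Qed.

Lemma lower_coversP x y : (x < y)%O ->
  exists a b, [/\ a != b, LC y = [set a; b] & (x <= a)%O].
Proof.
move=> xy.
case: (@arg_maxnP _ x (fun c => (x <= c < y)%O) rk); first by rewrite lexx.
move=> c /andP[xc cy] cmax.
have cL : c \in LC y.
  rewrite inE /covers !inE cy /=; apply/forall_inP => z _; apply/negP => /andP[cz zy].
  have := cmax z; rewrite zy (le_trans xc (ltW cz)) => /(_ isT).
  by rewrite /= leqNgt (rk_lt cz).
have /eqP/cards2P[a [b [ab e]]] : #|LC y| = 2.
  case: hP => [[_ H _ _] _]; apply: H; rewrite !inE /= andbT.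
  by apply/negP => /forall_inP/(_ x); rewrite inE xy => /(_ isT).
move: cL; rewrite e !inE => /orP[]/eqP E; subst c; first by exists a, b.
by exists b, a; rewrite eq_sym setUC.
Qed.

Lemma lower_covers_inj g g' a b : a != b ->
  LC g = [set a; b] -> LC g' = [set a; b] -> g = g'.
Proof.
move=> ab e e'; case: hP => [[_ _ H _] _].
have [ag bg] : a \in LC g /\ b \in LC g by rewrite e !inE !eqxx orbT.
have [ag' bg'] : a \in LC g' /\ b \in LC g' by rewrite e' !inE !eqxx orbT.
apply: (H a b) => //; try by [rewrite inE | move: ag bg ag' bg'; rewrite !inE].
by apply/eq_add_S; rewrite -(rk_lower_cover ag) -(rk_lower_cover bg).
Qed.

Lemma exists_minimal x : exists2 m, m \in P1 & (m <= x)%O.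
Proof.
case: (@arg_minnP _ x (fun c => (c <= x)%O) rk) => // m mx mmin.
exists m => //; rewrite !inE /=; apply/forall_inP => z _; apply/negP => zm.
have := mmin z (le_trans (ltW zm) mx); by rewrite /= leqNgt (rk_lt zm).
Qed.

Lemma exists_between v g t : (v <= g)%O -> rk v <= t <= rk g ->
  exists2 w, (v <= w <= g)%O & rk w = t.
Proof.
move=> + /andP[vt]; move En: (rk g - t) => n.
elim: n g En => [|n IH] g En vg tg.
  by exists g; [rewrite vg lexx | apply/eqP; rewrite eqn_leq tg -subn_eq0 En].
have tg' : t < rk g by rewrite -subn_gt0 En.
have vg' : (v < g)%O.
  rewrite lt_neqAle vg andbT; apply: contraTneq tg' => <-.
  by rewrite -leqNgt.
have [a [b [_ e va]]] := lower_coversP vg'.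
have aL : a \in LC g by rewrite e !inE eqxx.
have ra := rk_lower_cover aL.
have [|||w /andP[vw wa] rw] := IH a => //.
- by apply/eqP; rewrite -eqSS -En ra subSn // -ltnS -ra.
- by rewrite -ltnS -ra.
by exists w => //; rewrite vw (le_trans wa (ltW (lower_cover_lt aL))).
Qed.

(** * The forest formed by the level graphs *)

(* An edge of some F_i is the pair covered by an element of P_(i+1); since such
   pairs have constant rank, all the F_i are treated as a single forest. *)
Definition edge B : rel T :=
  fun a b => (a != b) && [exists g in B, LC g == [set a; b]].

Lemma edgeP B a b :
  reflect (a != b /\ exists2 g, g \in B & LC g = [set a; b]) (edge B a b).
Proof.
apply: (iffP andP) => [[ab /exists_inP[g gB /eqP e]]|[ab [g gB e]]].
  by split=> //; exists g.
by split=> //; apply/exists_inP; exists g => //; apply/eqP.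
Qed.

Lemma edge_sym B : symmetric (edge B).
Proof. by move=> a b; rewrite /edge eq_sym setUC. Qed.

Lemma edge_connect_sym B : connect_sym (edge B).
Proof. by apply: sym_connect_sym; apply: edge_sym. Qed.

Lemma connect_edgeS B B' x y :
  B \subset B' -> connect (edge B) x y -> connect (edge B') x y.
Proof.
move=> sB; apply: connect_sub => a b /edgeP[ab [g gB e]].
by apply/connect1/edgeP; split=> //; exists g => //; apply: (subsetP sB).
Qed.

Lemma edge_rk B a b : edge B a b -> rk a = rk b.
Proof.
move=> /edgeP[_ [g _ e]].
have [ag bg] : a \in LC g /\ b \in LC g by rewrite e !inE !eqxx orbT.
by apply/eq_add_S; rewrite -(rk_lower_cover ag) -(rk_lower_cover bg).
Qed.

Lemma connect_edge_rk B a b : connect (edge B) a b -> rk a = rk b.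
Proof.
move=> /connectP[p]; elim: p a => [|c p IH] a /=; first by move=> _ ->.
by move=> /andP[/edge_rk-> /IH].
Qed.

Lemma edge_adj B a b : edge B a b -> adj (level_graph [set: T] rk (rk a)) a b.
Proof.
move=> ab; have := ab => /edgeP[nab [g gB e]].
rewrite /adj !inE -(edge_rk ab) eqxx nab -e imset_f // !inE.
by rewrite (@rk_lower_cover a) ?eqxx // e !inE eqxx.
Qed.

(** A path from [a] to [b] avoiding the edge of [g] would close up with it to a cycle in a
    forest. *)
Lemma bridge g a b :
  a != b -> LC g = [set a; b] -> ~~ connect (edge [set~ g]) a b.
Proof.
move=> ab e; apply/negP => /connectP[p0 pp0 eb]; move: eb ab e.
case: (shortenP pp0) => p pp up _ -> {b} ab e.
have Ein := edge_adj (B := [set~ g]).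
have ag : a \in LC g by rewrite e !inE eqxx.
have bE : edge [set: T] a (last a p) by apply/edgeP; split=> //; exists g.
have rp x : x \in a :: p -> rk x = rk a.
  by move=> xp; apply/esym/connect_edge_rk; apply: path_connect pp _ xp.
have: size (a :: p) < 3.
  case: hP => [[_ _ _ F] _]; apply: (F (rk a)).
  - rewrite rk_gt0 /= -ltnS -(rk_lower_cover ag).
    by rewrite ltnW // ltnS; apply: leq_bigmax_cond; rewrite inE.
  - by move=> x /rp rx; rewrite !inE rx eqxx.
  - apply/andP; split=> //; rewrite /= rcons_path; apply/andP; split.
      apply: (sub_in_path (P := [in a :: p])) pp; last exact/allP.
      by move=> x y xa _; rewrite -(rp x xa); apply: edge_adj.
    by rewrite (edge_rk bE); apply: (edge_adj (B := [set: T])); rewrite edge_sym.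
(* The size bound leaves the empty path, excluded by [a != b], or a single edge, whose common cover
   can only be [g]. *)
case: p pp up ab e bE rp {ag} => [|z [|//]] /=; first by rewrite eqxx.
move=> /andP[/edgeP[az [h hg ha]] _] _ _ e _ _ _.
by move: hg; rewrite (lower_covers_inj az ha e) !inE eqxx.
Qed.

(** The first edge of a simple path in [B] is a bridge of the whole forest, so the connection in
    [B'] must use it too. *)
Lemma shared_edge B B' x y : x != y ->
  connect (edge B) x y -> connect (edge B') x y ->
  exists2 g, g \in B :&: B' & x \in LC g.
Proof.
move=> + /connectP[p0 pp0 ey]; rewrite {y}ey.
case: (shortenP pp0) => p pp up _; case: p pp up => [|z p] /=.
  by rewrite eqxx.
move=> /andP[/edgeP[xz [g gB e]] pp] /andP[xp _] _ cB'.
exists g; last by rewrite e !inE eqxx.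
rewrite inE gB /=; apply: contraT => gB'.
have := bridge xz e; rewrite (@connect_trans _ _ (last z p)) //.
  apply: connect_edgeS cB'; apply/subsetP => h; rewrite !inE.
  by apply: contraTneq => ->.
rewrite edge_connect_sym; apply/connectP; exists p => //.
apply: (sub_in_path (P := [in z :: p])) pp; last exact/allP.
(* The rest of the path avoids [x], hence also the edge of [g]. *)
move=> a b ap bp /edgeP[ab [h _ eh]]; apply/edgeP; split=> //; exists h => //.
rewrite !inE; apply: contraNneq xp => hg; rewrite hg e in eh.
have : x \in [set a; b] by rewrite -eh !inE eqxx.
by rewrite !inE => /orP[]/eqP->.
Qed.

(** * Supports, meets and joins *)

Lemma minimals_ideal x : minimals (principal_ideal [set: T] x) = U x.
Proof.
rewrite down_set_minimals; last exact: down_set_ideal.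
by apply/setP => m; rewrite !inE.
Qed.

(** The ideal below [x] is an R-vine, so its rank [rk x] equals its number of minimal elements. *)
Lemma card_support x : #|U x| = rk x.
Proof.
case: hP => [_ /(_ x)]; rewrite inE => /(_ isT) [_].
rewrite /dim minimals_ideal => <- _ _.
apply/eqP; rewrite eqn_leq; apply/andP; split.
  by apply/bigmax_leqP => y; rewrite !inE => /rk_le.
by apply: leq_bigmax_cond; rewrite !inE lexx.
Qed.

Lemma ideal_connected x a b : (a <= x)%O -> (b <= x)%O -> rk a = rk b ->
  connect (edge (principal_ideal [set: T] x)) a b.
Proof.
move=> ax bx ab; case: hP => [_ /(_ x)]; rewrite inE => /(_ isT) [_ _ H _].
have [|_ /(_ a b) + _] := H (rk a).
  by rewrite rk_gt0; apply: leq_bigmax_cond; rewrite !inE.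
rewrite !inE ax bx ab !eqxx => /(_ isT isT).
apply: connect_sub => a' b' /and4P[_ _ nab /imsetP[v]].
rewrite !inE => /andP[vx _] e; apply/connect1/edgeP; split=> //.
exists v; first by rewrite !inE.
by rewrite e down_set_lower_covers //; [apply: down_set_ideal | rewrite !inE].
Qed.

Lemma meet_exists m v w : (m <= v)%O -> (m <= w)%O ->
  exists q, [/\ (q <= v)%O, (q <= w)%O
    & forall x, (x <= v)%O -> (x <= w)%O -> (x <= q)%O].
Proof.
move=> mv mw; pose Q := [pred q | (q <= v)%O && (q <= w)%O].
have Qle x y : Q x -> (y <= x)%O -> Q y.
  by move=> /andP[xv xw] yx; rewrite /Q /= !(le_trans yx).
(* Levels of Q are connected, so a maximal element of Q is alone on its level. *)
have Qmax x y : Q x -> Q y -> rk x = rk y ->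
    (forall z, Q z -> (x < z)%O -> False) -> x = y.
  move=> /andP[xv xw] /andP[yv yw] xy xmax; apply/eqP; apply: contraT => nxy.
  have [g] := shared_edge nxy (ideal_connected xv yv xy) (ideal_connected xw yw xy).
  by move=> gQ /lower_cover_lt xg; case: (xmax g) => //; move: gQ; rewrite !inE.
case: (@arg_maxnP _ m Q rk) => [|q Qq qmax]; first by rewrite /Q /= mv.
exists q; move: (Qq) => /andP[qv qw]; split=> // x0 xv xw.
case: (@arg_maxnP _ x0 (fun x => Q x && (x0 <= x)%O) rk) => [|x].
  by rewrite /Q /= xv xw lexx.
move=> /andP[Qx x0x] xmax.
(* Some [y] below [q] has the rank of the maximal element [x]; then [Qmax] gives [x = y], so [x]
   lies below [q]. *)
have [m0 m0P m0q] := exists_minimal q.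
have [||y /andP[_ yq] ry] := @exists_between m0 q (rk x) => //.
  by rewrite (rk_minimal m0P) rk_gt0; apply: qmax.
rewrite (le_trans x0x) // (Qmax x y) ?ry //; first exact: Qle yq.
move=> z Qz xz; have := xmax z; rewrite Qz (le_trans x0x (ltW xz)) => /(_ isT).
by rewrite /= leqNgt (rk_lt xz).
Qed.

Lemma mem_support x m : (m \in U x) = (m \in P1) && (m <= x)%O.
Proof. by rewrite inE. Qed.

Lemma support_minimal x m : m \in U x -> m \in P1.
Proof. by rewrite mem_support => /andP[]. Qed.

Lemma supportS x y : (x <= y)%O -> U x \subset U y.
Proof.
move=> xy; apply/subsetP => m; rewrite !mem_support => /andP[-> mx].
exact: le_trans mx xy.
Qed.

(** The meet of two elements with equal supports has the same support, hence the same rank, and so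
    equals both. *)
Lemma support_inj : injective U.
Proof.
have H v w : U v = U w -> (v <= w)%O.
  move=> e; have [m mP mv] := exists_minimal v.
  have mw : (m <= w)%O.
    by have : m \in U w by [rewrite -e mem_support mP]; rewrite mem_support => /andP[].
  have [q [qv qw qmax]] := meet_exists mv mw.
  rewrite -(le_rk_eq qv) //; apply/eqP; rewrite -!card_support.
  rewrite eqn_leq subset_leq_card ?supportS //=; apply/subset_leq_card/subsetP.
  move=> u uv; have := uv; rewrite {1}e !mem_support in uv *.
  move=> /andP[-> uw]; case/andP: uv => _ uv; exact: qmax.
by move=> v w e; apply: le_anti; rewrite !H.
Qed.

(** An upper bound [q] of least rank below [z] equals its meet with any other upper bound [w]. *)
Lemma join_exists i j z : (i <= z)%O -> (j <= z)%O ->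
  exists2 q, is_join [set: T] [set i; j] q & (q <= z)%O.
Proof.
move=> iz jz.
case: (@arg_minnP _ z (fun q => [&& (i <= q)%O, (j <= q)%O & (q <= z)%O]) rk).
  by rewrite iz jz lexx.
move=> q /and3P[iq jq qz] qmin; exists q => //; rewrite /is_join inE /=.
apply/andP; split.
  by apply/forall_inP => x; rewrite !inE => /orP[]/eqP->.
apply/forall_inP => w _; apply/implyP => /forall_inP wub.
have [iw jw] : (i <= w)%O /\ (j <= w)%O by split; apply: wub; rewrite !inE eqxx ?orbT.
have [p [pq pw pmax]] := meet_exists iq iw.
suff <- : p = q by [].
apply: le_rk_eq => //; apply/eqP; rewrite eqn_leq rk_le //=.
by apply: qmin; rewrite !pmax // (le_trans pq).
Qed.

Lemma join_unique (e : {set T}) q q' :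
  is_join [set: T] e q -> is_join [set: T] e q' -> q = q'.
Proof.
move=> /and3P[_ u1 /forall_inP l1] /and3P[_ u2 /forall_inP l2].
apply: le_anti; rewrite (implyP (l1 q' _)) ?inE //.
by rewrite (implyP (l2 q _)) ?inE.
Qed.

(** * Labels and simple elements *)

Lemma label_Omega e q :
  is_join [set: T] e q -> label (Omega [set: T] rk) e = (rk q).-1.
Proof.
by move=> qe; rewrite /=; case: pickP => [z qz|/(_ q)]; rewrite ?qe // (join_unique qe qz).
Qed.

Definition simple_in S v : Prop :=
  forall y y', (v <= y)%O -> (v <= y')%O -> U y \subset S -> U y' \subset S ->
    rk y = rk y' -> y = y'.

(* The |U_y| - 1 joins of v with the other elements of U_y have distinct labels
   below rk y = |U_y|, so U_y is determined by rk y. *)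
Lemma MS2_simple_in S v : v \in P1 -> v \in S ->
  MS2 (induced (Omega [set: T] rk) S) v -> simple_in S v.
Proof.
move=> vP vS; set G := induced _ _ => ms2.
pose N := neighbors G v; pose lab u := label G [set u; v].
(* The labels at [v] take [deg G v] values on as many neighbors, so none repeats. *)
have labU : uniq (map lab (enum N)).
  apply: (@leq_size_uniq _ (iota 1 (deg G v))); first exact: iota_uniq.
  - move=> k; rewrite mem_iota add1n ltnS => /ms2[u uN <-].
    by apply/mapP; exists u; rewrite ?mem_enum.
  - by rewrite size_map size_iota -cardE.
(* Joins with [v] give one inclusion. Equality follows by counting: the right side has distinct
   labels from 1 to [rk y - 1], and the left side has [rk y - 1] elements. *)
have key y : (v <= y)%O -> U y \subset S ->
    U y :\ v = [set u in N | lab u < rk y].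
  move=> vy yS; have vy' : v \in U y by rewrite mem_support vP.
  apply/eqP; rewrite eqEcard; apply/andP; split.
    apply/subsetP => u; rewrite in_setD1 => /andP[uv uy].
    have uP := support_minimal uy; have uS := subsetP yS u uy.
    have uy' : (u <= y)%O by move: uy; rewrite mem_support => /andP[].
    have [q jq qy] := join_exists uy' vy.
    rewrite inE /lab (label_Omega jq); apply/andP; split.
      rewrite inE.
      have sub (X : {set T}) : u \in X -> v \in X -> [set u; v] \subset X.
        by rewrite subUset !sub1set => -> ->.
      apply/and4P; split; [exact/setIP | exact/setIP | by rewrite eq_sym |].
      rewrite setUC inE sub // andbT inE sub // cards2 uv /=.
      by apply/existsP; exists q.
    by rewrite prednK ?rk_gt0 // rk_le.
  have -> : #|U y :\ v| = (rk y).-1 by rewrite -card_support (cardsD1 v (U y)) vy'.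
  set X := [set u in N | _]; rewrite cardE -(size_map lab) -[X in _ <= X](size_iota 1).
  apply: uniq_leq_size.
    rewrite map_inj_in_uniq ?enum_uniq // => u u'; rewrite !mem_enum !inE.
    move=> /andP[uN _] /andP[uN' _].
    by apply: (elimT (dinjectiveP lab N) labU); rewrite inE.
  move=> k /mapP[u]; rewrite mem_enum inE => /andP[uN ul ->].
  rewrite mem_iota add1n prednK ?rk_gt0 // ul andbT.
  by have /andP[] := (ms2 (lab u)).1 (ex_intro2 _ _ u uN erefl).
move=> y y' vy vy' yS yS' r; apply: support_inj.
by rewrite -(@setD1K _ v (U y)) ?key // ?r -?key ?setD1K // mem_support vP.
Qed.

(** * Marginalization at a simple element *)

Definition restriction S : {set T} := [set x | U x \subset S].

Lemma down_set_restriction S : down_set (restriction S).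
Proof. by move=> x y; rewrite !inE => xS /supportS yx; apply: subset_trans yx xS. Qed.

Lemma restrictionS S S' : S \subset S' -> restriction S \subset restriction S'.
Proof.
by move=> SS'; apply/subsetP => x; rewrite !inE => xS; apply: subset_trans xS SS'.
Qed.

Lemma restriction_setU1 S v x : v \in P1 -> v \notin S ->
  (x \in restriction S) = (x \in restriction (v |: S)) && ~~ (v <= x)%O.
Proof.
by move=> vP vS; rewrite -{1}(setU1K vS) !inE subsetD1 mem_support vP.
Qed.

(** The two lower covers have equal rank, so simplicity keeps them from both lying above [v]. *)
Lemma simple_lower_covers S v x :
  simple_in S v -> x \in restriction S -> (v < x)%O ->
  exists c f, [/\ c != f, LC x = [set c; f], (v <= c)%O & ~~ (v <= f)%O].
Proof.
move=> vs xS vx; have [c [f [cf e vc]]] := lower_coversP vx.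
exists c, f; split=> //; apply: contraNN cf => vf; apply/eqP.
have [cL fL] : c \in LC x /\ f \in LC x by rewrite e !inE !eqxx orbT.
have sub a : a \in LC x -> U a \subset S.
  move=> /lower_cover_lt/ltW ax.
  by have := down_set_restriction xS ax; rewrite inE.
apply: vs; rewrite ?sub //; apply/eq_add_S.
by rewrite -(rk_lower_cover cL) -(rk_lower_cover fL).
Qed.

(** An element strictly above [v] has exactly one lower cover above [v], so [v] lies in its
    conditioned set; conversely, conditioned sets lie in supports. *)
Lemma marginalization_simple S v : v \in P1 -> v \notin S ->
  simple_in (v |: S) v -> marginalization (restriction (v |: S)) v = restriction S.
Proof.
move=> vP vS vs; set A := restriction _; have dA : down_set A by exact: down_set_restriction.
apply/setP => x; rewrite (restriction_setU1 x vP vS) -/A in_setD andbC.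
case: (boolP (x \in A)) => //= xA; congr (~~ _).
have inU a : (v \in U a) = (v <= a)%O by rewrite mem_support vP.
rewrite in_setU1 inE xA /=; have [->|xv] := eqVneq x v; first by rewrite lexx.
have supA a : a \in LC x -> Defs.support A a = U a.
  by move=> /lower_cover_lt/ltW ax; rewrite down_set_support // (dA _ _ xA ax).
apply/bigcupP/idP => [[a]|vx]; rewrite down_set_lower_covers //.
  move=> aL /bigcupP[b bL].
  have [ax bx] := (ltW (lower_cover_lt aL), ltW (lower_cover_lt bL)).
  rewrite /symdiff !supA // in_setU !in_setD !inU.
  by move=> /orP[]/andP[_ vab]; [apply: le_trans vab ax | apply: le_trans vab bx].
have vx' : (v < x)%O by rewrite lt_neqAle eq_sym xv.
have [c [f [cf e vc vf]]] := simple_lower_covers vs xA vx'.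
have [cL fL] : c \in LC x /\ f \in LC x by rewrite e !inE !eqxx orbT.
exists c => //; apply/bigcupP; exists f => //.
by rewrite /symdiff !supA // in_setU !in_setD !inU vc vf.
Qed.

Lemma sampling_order_simple (l : nat) (v : l.-tuple T) :
  ordering_of P1 v ->
  (forall i : 'I_l, simple_in [set x in take i.+1 v] (tnth v i)) ->
  sampling_order [set: T] rk v.
Proof.
move=> [uv vP] vs; split=> // i /andP[_ il].
suff -> : marginal [set: T] v i = restriction [set x in take i v].
  by apply: down_set_LRvine hP _; apply: down_set_restriction.
(* Descending induction from [i = l], where nothing has been removed yet. *)
move: (leq_trans il (leq_pred l)) => {il}; move En: (l - i) => n.
elim: n i En => [|n IH] i En il.
  have -> : i = l by apply/eqP; rewrite eqn_leq il -subn_eq0 En.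
  rewrite /marginal drop_oversize ?size_tuple //=; apply/setP => x.
  rewrite take_oversize ?size_tuple // !inE; apply/esym/subsetP => m /support_minimal.
  by rewrite inE vP.
have il' : i < l by rewrite -subn_gt0 En.
have e : tnth v (Ordinal il') = nth (tnth v (Ordinal il')) v i by exact: tnth_nth.
rewrite /marginal (drop_nth (tnth v (Ordinal il'))) ?size_tuple //= -e.
rewrite -/(marginal [set: T] v i.+1) IH //; last by rewrite subnS En.
have := vs (Ordinal il'); rewrite /= (take_nth (tnth v (Ordinal il'))) ?size_tuple // -e.
have -> : [set x in rcons (take i v) (tnth v (Ordinal il'))]
    = tnth v (Ordinal il') |: [set x in take i v].
  by apply/setP => x; rewrite !inE mem_rcons inE.
apply: marginalization_simple; first by rewrite -vP mem_tnth.
rewrite inE; have := take_uniq i.+1 uv.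
by rewrite (take_nth (tnth v (Ordinal il'))) ?size_tuple // -e rcons_uniq => /andP[].
Qed.

(** * Existence of an ordering by simple elements *)

(** The part supported in [S] meets each component of the forest in a subtree or not at all;
    elements covering the connecting edges must be supported in [S] too. *)
Definition convex S : Prop :=
  {in restriction S &, forall x y,
    connect (edge [set: T]) x y -> connect (edge (restriction S)) x y}.

(* At the lowest rank where uniqueness fails, c has two covers {c, f} and
   {c, f'} with f, f' in the restriction to S; together with a path from f to
   f' in that restriction they form a cycle. *)
Lemma convex_simple_in S v : convex S -> v \in P1 -> v \notin S ->
  simple_in (v |: S) v.
Proof.
move=> cS vP vS y y'; have [n] := ubnP (rk y).
elim: n y y' => // n IH y y' yn vy vy' yS yS' r.
have [vy0|nvy] := eqVneq v y.
  by subst y; apply: le_rk_eq.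
have {nvy} lvy : (v < y)%O by rewrite lt_neqAle nvy.
have {vy} lvy' : (v < y')%O.
  rewrite lt_neqAle vy' andbT; apply: contraTneq (rk_lt lvy) => ->.
  by rewrite r ltnn.
have [c [f [cf e vc]]] := lower_coversP lvy.
have [c' [f' [cf' e' vc']]] := lower_coversP lvy'.
have [cL fL] : c \in LC y /\ f \in LC y by rewrite e !inE !eqxx orbT.
have [cL' fL'] : c' \in LC y' /\ f' \in LC y' by rewrite e' !inE !eqxx orbT.
have sub z a : U z \subset v |: S -> a \in LC z -> U a \subset v |: S.
  by move=> zS /lower_cover_lt/ltW/supportS az; apply: subset_trans az zS.
(* By induction on the rank, the lower covers of [y] and [y'] above [v] all coincide. *)
have IH' a b : a \in LC y -> b \in LC y \/ b \in LC y' ->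
    (v <= a)%O -> (v <= b)%O -> a = b.
  move=> aL bL va vb; apply: IH => //; last 1 first.
  - apply/eq_add_S; rewrite -(rk_lower_cover aL).
    by case: bL => /rk_lower_cover <-.
  - by rewrite -ltnS -(rk_lower_cover aL).
  - exact: sub aL.
  - by case: bL => [/(sub _ _ yS)|/(sub _ _ yS')].
have ec : c = c' by apply: IH'; auto.
subst c'; apply/eqP; apply: contraT => nyy.
have fS : f \in restriction S.
  rewrite (restriction_setU1 f vP vS) inE (sub y) //=.
  by apply: contraNN cf => vf; apply/eqP/IH'; auto.
have fS' : f' \in restriction S.
  rewrite (restriction_setU1 f' vP vS) inE (sub y') //=.
  by apply: contraNN cf' => vf; apply/eqP/IH'; auto.
have eE : edge [set: T] f c.
  by rewrite edge_sym; apply/edgeP; split=> //; exists y.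
have eE' B : y' \in B -> edge B c f'.
  by move=> yB; apply/edgeP; split=> //; exists y'.
have ff' := cS f f' fS fS' (connect_trans (connect1 eE) (connect1 (eE' _ (in_setT _)))).
(* The path from [f] to [f'] avoids [y], which lies above [v]; with the edge of [y'] it bypasses the
   bridge given by [y]. *)
have := bridge cf e; rewrite edge_connect_sym (@connect_trans _ _ f') //.
  apply: connect_edgeS ff'; apply/subsetP => z; rewrite !inE.
  apply: contraTneq => ->; apply/negP => /subsetP/(_ v).
  by rewrite mem_support vP (ltW lvy) => /(_ isT); apply/negP.
by apply: connect1; rewrite edge_sym; apply: eE'; rewrite !inE eq_sym.
Qed.

Lemma connect_exit (e : rel T) (p : pred T) x y :
  connect e x y -> p x -> ~~ p y -> exists a b, [/\ e a b, p a & ~~ p b].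
Proof.
move=> /connectP[s]; elim: s x => [|z s IH] x /=; first by move=> _ -> ->.
move=> /andP[xz zs] ey px py; case: (boolP (p z)) => pz; first exact: IH zs ey pz py.
by exists x, z.
Qed.

(** Among the elements with exactly one minimal element outside [S], take [g] of maximal rank, and
    let [v] be that minimal element. Any element above [v] that must be linked to the part supported
    in [S] is then adjacent to it, through an element below [g]. *)
Lemma convex_extend S m : convex S -> m \in P1 -> m \notin S ->
  exists v, [/\ v \in P1, v \notin S & convex (v |: S)].
Proof.
move=> cS mP mS.
have Um : U m = [set m].
  have /eqP/cards1P[a e] : #|U m| = 1 by rewrite card_support rk_minimal.
  have : m \in U m by rewrite mem_support mP lexx.
  by rewrite e inE => /eqP->.
case: (@arg_maxnP _ m (fun g => #|U g :\: S| == 1) rk) => [|g /cards1P[v ev] gmax].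
  apply/cards1P; exists m; rewrite Um; apply/setP => z; rewrite !inE.
  by case: eqVneq => [->|]; rewrite ?mS ?andbF.
have : v \in U g :\: S by rewrite ev inE.
rewrite inE => /andP[vS vg]; have vP := support_minimal vg.
move: vg; rewrite mem_support => /andP[_ vg].
have gS : U g \subset v |: S by rewrite setUC -subDset ev.
have vs := convex_simple_in cS vP vS.
exists v; split=> //.
have key x y : x \in restriction (v |: S) -> y \in restriction S -> (v <= x)%O ->
    connect (edge [set: T]) x y ->
    exists2 h, h \in restriction S & edge (restriction (v |: S)) x h.
  move=> xS yS vx xy.
  have xS' : x \notin restriction S by rewrite (restriction_setU1 _ vP vS) vx andbF.
  have yx : connect (edge [set: T]) y x by rewrite edge_connect_sym.
  (* Edges preserve rank, so a path leaves [p] only by leaving the restriction to [S]. *)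
  pose p := [pred z | (z \in restriction S) && (rk z == rk x)].
  have [a [b [ab /andP[aS /eqP ra]]]] : exists a b, [/\ edge [set: T] a b, p a & ~~ p b].
    apply: (connect_exit yx); first by rewrite /p /= yS (connect_edge_rk yx) eqxx.
    by rewrite /p /= (negbTE xS').
  rewrite /p /= -(edge_rk ab) ra eqxx andbT => bS.
  have [_ [h _ eh]] := edgeP _ _ _ ab.
  have [aL bL] : a \in LC h /\ b \in LC h by rewrite eh !inE !eqxx orbT.
  (* [U h] has one element more than [U a], which lies in [S], and is not itself inside [S] because
     [U b] is not. *)
  have hg : rk h <= rk g.
    apply: gmax; rewrite eqn_leq; apply/andP; split.
      have -> : 1 = #|U h| - #|U a| by rewrite !card_support (rk_lower_cover aL) subSnn.
      rewrite cardsD leq_sub2l // subset_leq_card // subsetI.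
      by rewrite supportS ?(ltW (lower_cover_lt aL)) //; rewrite inE in aS.
    rewrite card_gt0; apply: contraNneq bS => /eqP; rewrite setD_eq0 => hS.
    by rewrite inE; apply: subset_trans hS; apply/supportS/ltW/lower_cover_lt.
  (* Since [rk h <= rk g], some [w] between [v] and [g] has rank [rk x + 1]. By simplicity its lower
     cover above [v] is [x]; the other one is supported in [S]. *)
  have [|w /andP[vw wg] rw] := exists_between (t := (rk x).+1) vg.
    by rewrite (rk_minimal vP) /= -ra -(rk_lower_cover aL).
  have vw' : (v < w)%O.
    rewrite lt_neqAle vw andbT; apply/eqP => e.
    by have := rk_gt0 x; rewrite -ltnS -rw -e (rk_minimal vP).
  have wS : w \in restriction (v |: S) by rewrite inE (subset_trans (supportS wg)).
  have [c [f [cf e vc vf]]] := simple_lower_covers vs wS vw'.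
  have [cL fL] : c \in LC w /\ f \in LC w by rewrite e !inE !eqxx orbT.
  have inS z : z \in LC w -> z \in restriction (v |: S).
    by move=> /lower_cover_lt/ltW; apply: down_set_restriction wS.
  have ec : c = x.
    apply: vs => //; try by [have := inS _ cL; rewrite inE | move: xS; rewrite inE].
    by apply/eq_add_S; rewrite -rw (rk_lower_cover cL).
  exists f; first by rewrite (restriction_setU1 _ vP vS) inS.
  by rewrite -ec; apply/edgeP; split=> //; exists w.
have mono := connect_edgeS (restrictionS (subsetUr [set v] S)).
have key' x y : x \in restriction (v |: S) -> y \in restriction S -> (v <= x)%O ->
    connect (edge [set: T]) x y -> connect (edge (restriction (v |: S))) x y.
  move=> xS yS vx xy; have [h hS xh] := key x y xS yS vx xy.
  apply: connect_trans (connect1 xh) (mono _ _ (cS h y hS yS _)).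
  apply: connect_trans _ xy; rewrite edge_connect_sym.
  by apply: connect_edgeS (connect1 xh); apply: subsetT.
move=> x y xS yS xy; case: (boolP (v <= x)%O) => vx; case: (boolP (v <= y)%O) => vy.
- have -> // : x = y; apply: vs => //; try by [move: xS yS; rewrite !inE].
  exact: connect_edge_rk xy.
- by apply: key' => //; rewrite (restriction_setU1 _ vP vS) yS.
- rewrite edge_connect_sym; apply: key' => //; last by rewrite edge_connect_sym.
  by rewrite (restriction_setU1 _ vP vS) xS.
- by apply/mono/cS; rewrite ?(restriction_setU1 _ vP vS) ?xS ?yS.
Qed.

Lemma exists_simple_ordering : exists v : (dim [set: T]).-tuple T,
  ordering_of P1 v /\
  forall i : 'I_(dim [set: T]), simple_in [set x in take i.+1 v] (tnth v i).
Proof.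
(* The list grows by one element at a time; convexity of its set is the invariant that allows the
   next extension. *)
suff H k : k <= #|P1| -> exists s : seq T, [/\ uniq s, size s = k, {subset s <= P1},
    convex [set x in s] &
    forall s1 v s2, s = rcons s1 v ++ s2 -> simple_in [set x in rcons s1 v] v].
  have [s [us ss sP _ sv]] := H _ (leqnn _).
  have ss' : size s == dim [set: T] by apply/eqP.
  exists (Tuple ss'); split.
    split=> //; apply/subset_cardP; first by rewrite (card_uniqP us).
    by apply/subsetP.
  move=> i; rewrite (tnth_nth (tnth (Tuple ss') i)) /= (take_nth (tnth (Tuple ss') i)).
    apply: (sv _ _ (drop i.+1 s)); rewrite -take_nth ?cat_take_drop //.
    by rewrite ss.
  by rewrite ss.
elim: k => [_|k IH kP].
  exists [::]; split=> //; last by move=> [|? ?].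
  (* The empty set is convex because no element has empty support. *)
  move=> x y; rewrite inE => /subset_leq_card; rewrite card_support.
  have -> : [set z in [::]] = set0 :> {set T} by apply/setP => z; rewrite !inE.
  by rewrite cards0 leqNgt rk_gt0.
have [s [us ss sP cs sv]] := IH (ltnW kP).
have [m mP ms] : exists2 m, m \in P1 & m \notin [set x in s].
  apply/subsetPn; apply: contraL kP => /subset_leq_card.
  by rewrite [#|[set x in s]|]cardsE (card_uniqP us) ss -leqNgt.
have [v [vP vS cv]] := convex_extend cs mP ms.
have e : [set x in rcons s v] = v |: [set x in s].
  by apply/setP => x; rewrite !inE mem_rcons inE.
exists (rcons s v); split; rewrite ?size_rcons ?ss ?e //.
- by rewrite rcons_uniq us andbT; move: vS; rewrite inE.
- by move=> x; rewrite mem_rcons inE => /predU1P[->|/sP].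
move=> s1 u s2; case: (lastP s2) => [|s2' u'].
  by rewrite cats0 => /rcons_inj[<- <-]; rewrite e; apply: convex_simple_in.
by rewrite -rcons_cat => /rcons_inj[/sv].
Qed.
End LRvines.

Theorem theorem7p8 (d : Order.disp_t) (T : finPOrderType d) (rk : T -> nat)
    (l : nat) (hP : is_LRvine [set: T] rk) (hl : dim [set: T] = l) :
  (forall v : l.-tuple T,
     MAT_PEO (Omega [set: T] rk) v -> sampling_order [set: T] rk v)
  /\ (exists v : l.-tuple T, sampling_order [set: T] rk v).
Proof.
split; last first.
  subst l; have [v [ov vs]] := exists_simple_ordering hP.
  by exists v; apply: sampling_order_simple.
move=> v [ov vs]; apply: sampling_order_simple => // i.
have [vV _ ms2 _] := vs i; move: vV => /setIP[vP vS].
exact: MS2_simple_in ms2.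
Qed.
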